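(* Let $\{\mathcal{R}_A\}$ be a zero-divisor functorial family with associated zero-divisor functor $\zeta$, let $A,B$ be rings and $f,g:A\to B$ ring homomorphisms. Then the canonical graph morphism $\psi:\zeta(\operatorname{Eq}(f,g))\to\operatorname{Eq}(\zeta(f),\zeta(g))$ is a strong graph morphism. Moreover: 1. if $\{\mathcal{R}_A\}$ satisfies the following property: for all rings $A,B$ and homomorphisms $f,g:A\to B$, $$a\,\mathcal{R}_A\,a'\Longrightarrow a\,\mathcal{R}_{\operatorname{Eq}(f,g)}\,a'\quad\text{for all }a,a'\in\operatorname{Eq}(f,g),$$ then $\psi$ is a graph monomorphism; 2. if $\{\mathcal{R}_A\}$ also satisfies the following property: for all rings $A,B$ and homomorphisms $f,g:A\to B$, $$f(a)\,\mathcal{R}_B\,g(a)\Longrightarrow \text{there exists } a'\in\operatorname{Eq}(f,g)\text{ such that } a\,\mathcal{R}_A\,a',\quad\text{for all }a\in A,$$ then $\psi$ is a graph epimorphism.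
   Context: All rings are commutative and unitary and homomorphisms preserve $1$. A graph $G=(V(G),E(G))$ is a set $V(G)$ with a symmetric binary relation $E(G)$ on it (loops allowed). A graph morphism is a map on vertices sending adjacent pairs to adjacent pairs; it is strong if moreover two vertices are adjacent whenever their images are. $\mathbf{Graph}$ is the category of graphs and graph morphisms; graph monomorphisms and epimorphisms are those of this category (morphisms injective, resp. surjective, on vertices). An equivalence relation $\mathcal{R}$ on a ring $A$ is a zero-divisor relation if, whenever $a\,\mathcal{R}\,a'$ and $b\,\mathcal{R}\,b'$, $ab=0$ implies $a'b'=0$. A zero-divisor functorial family $\{\mathcal{R}_A\}$ is a choice, for each ring $A$, of a zero-divisor relation $\mathcal{R}_A$ on $A$ such that for every ring homomorphism $f:A\to B$, $a\,\mathcal{R}_A\,a'$ implies $f(a)\,\mathcal{R}_B\,f(a')$. Its associated zero-divisor functor $\zeta:\mathbf{CRing}\to\mathbf{Graph}$ sends $A$ to the graph $\zeta(A)$ with vertex set $A/\mathcal{R}_A$ in which $[a],[b]$ are adjacent iff $ab=0$, and sends $f:A\to B$ to $\zeta(f):[a]\mapsto[f(a)]$. For ring homomorphisms $f,g:A\to B$, $\operatorname{Eq}(f,g)$ is the subring $\{a\in A: f(a)=g(a)\}$. For graph morphisms $\alpha,\beta:G_1\to G_2$, $\operatorname{Eq}(\alpha,\beta)$ is the subgraph of $G_1$ induced by the vertices on which $\alpha$ and $\beta$ coincide. The canonical morphism $\psi$ is the unique graph morphism, given by the universal property of the equalizer in $\mathbf{Graph}$, whose composite with the inclusion $\operatorname{Eq}(\zeta(f),\zeta(g))\to\zeta(A)$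 is the image under $\zeta$ of the inclusion $\operatorname{Eq}(f,g)\to A$. *)

(* Defs.v *)
From HB Require Import structures.
From Corelib Require Import RelationClasses.
From mathcomp Require Import all_boot all_order all_algebra generic_quotient.
From mathcomp Require Import boolp.

Set Implicit Arguments.
Unset Strict Implicit.
Unset Printing Implicit Defensive.

Import GRing.Theory.
Local Open Scope ring_scope.
Local Open Scope quotient_scope.

(* Rings are [comPzRingType]s: unlike in [comNzRingType], the zero ring is
   allowed, and it does occur as an object of CRing. *)

Record graph := Graph {
  vertex :> Type;
  adj : vertex -> vertex -> Prop;
  adj_sym : forall x y, adj x y -> adj y x
}.

Record gmor (G H : graph) := GMor {
  gmor_fun :> G -> H;
  gmor_adj : forall x y, adj x y -> adj (gmor_fun x) (gmor_fun y)
}.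

Definition gmor_comp (G H K : graph) (h : gmor H K) (k : gmor G H) : gmor G K :=
  @GMor G K (h \o k) (fun x y xy => gmor_adj h (gmor_adj k xy)).

Definition strong (G H : graph) (h : gmor G H) : Prop :=
  forall x y : G, adj (h x) (h y) -> adj x y.

(* Equality of graph morphisms is [=1]; a [gmor] also carries a proof, and [=1]
   coincides with [=] only by extensionality and proof irrelevance. *)
Definition graph_mono (G H : graph) (h : gmor G H) : Prop :=
  forall (K : graph) (k1 k2 : gmor K G),
    gmor_comp h k1 =1 gmor_comp h k2 -> k1 =1 k2.

Definition graph_epi (G H : graph) (h : gmor G H) : Prop :=
  forall (K : graph) (k1 k2 : gmor H K),
    gmor_comp k1 h =1 gmor_comp k2 h -> k1 =1 k2.

Lemma graph_monoP (G H : graph) (h : gmor G H) :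
  graph_mono h <-> injective h.
Proof.
split=> [mono_h x y hxy | inj_h K k1 k2 hk x]; last exact: inj_h (hk x).
pose P := @Graph unit (fun _ _ => False) (fun _ _ => id).
pose pt z := @GMor P G (fun=> z) (fun _ _ (F : False) => match F with end).
exact: (mono_h P (pt x) (pt y) (fun=> hxy) tt).
Qed.

Lemma graph_epiP (G H : graph) (h : gmor G H) :
  graph_epi h <-> (forall y : H, exists x : G, h x = y).
Proof.
split=> [epi_h y | surj_h K k1 k2 kh y]; last by have [x <-] := surj_h y; apply: kh.
pose P := @Graph Prop (fun _ _ => True) (fun _ _ => id).
pose k1 := @GMor H P (fun=> True) (fun _ _ _ => I).
pose k2 := @GMor H P (fun y => exists x, h x = y) (fun _ _ _ => I).
suff: k1 =1 k2 by move=> /(_ y) /= <-.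
by apply: epi_h => x /=; apply/propext; split=> // _; exists x.
Qed.

Definition induced (G : graph) (P : G -> Prop) : graph :=
  @Graph {x : G | P x} (fun x y => adj (sval x) (sval y))
    (fun x y xy => adj_sym xy).

Definition graph_eq (G H : graph) (h k : gmor G H) : graph :=
  induced (fun x : G => h x = k x).

Definition graph_eq_incl (G H : graph) (h k : gmor G H) :
    gmor (graph_eq h k) G :=
  @GMor (graph_eq h k) G sval (fun _ _ xy => xy).

Definition graph_eq_lift (G H K : graph) (h k : gmor G H) (m : gmor K G)
    (hm_km : gmor_comp h m =1 gmor_comp k m) : gmor K (graph_eq h k) :=
  @GMor K (graph_eq h k) (fun x => exist _ (m x) (hm_km x))
    (fun x y xy => gmor_adj m xy).

Lemma graph_eq_liftK (G H K : graph) (h k : gmor G H) (m : gmor K G)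
    (hm_km : gmor_comp h m =1 gmor_comp k m) :
  gmor_comp (graph_eq_incl h k) (graph_eq_lift hm_km) =1 m.
Proof. by []. Qed.

Lemma graph_eq_lift_uniq (G H K : graph) (h k : gmor G H) (m : gmor K G)
    (hm_km : gmor_comp h m =1 gmor_comp k m) (n : gmor K (graph_eq h k)) :
  gmor_comp (graph_eq_incl h k) n =1 m -> n =1 graph_eq_lift hm_km.
Proof.
move=> nm x; apply: eq_sig_hprop => [z p q|]; last exact: nm.
exact: Prop_irrelevance.
Qed.

Section RingEqualizer.
Variables (A B : comPzRingType) (f g : {rmorphism A -> B}).

Definition coincide : pred A := fun a => f a == g a.

Fact coincide_subring_closed : subring_closed coincide.
Proof.
split=> [|a b|a b]; rewrite /coincide !unfold_in ?rmorph1 //.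
  by move=> /eqP fga /eqP fgb; rewrite !rmorphB fga fgb.
by move=> /eqP fga /eqP fgb; rewrite !rmorphM fga fgb.
Qed.

Record ring_eq := RingEq {
  ring_eq_val : A;
  _ : coincide ring_eq_val
}.

HB.instance Definition _ := [isSub for ring_eq_val].
HB.instance Definition _ := [Choice of ring_eq by <:].
HB.instance Definition _ :=
  GRing.SubChoice_isSubComPzRing.Build A coincide ring_eq coincide_subring_closed.

Definition ring_eq_incl : {rmorphism ring_eq -> A} := \val.

Lemma ring_eq_inclP (x : ring_eq) : f (ring_eq_incl x) = g (ring_eq_incl x).
Proof. exact/eqP/(valP x). Qed.

End RingEqualizer.

Definition zd_relation (A : comPzRingType) (R : A -> A -> Prop) : Prop :=
  Equivalence R /\
  (forall a a' b b' : A, R a a' -> R b b' -> a * b = 0 -> a' * b' = 0).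

Record zd_family := ZdFamily {
  zd_rel : forall A : comPzRingType, A -> A -> Prop;
  zd_rel_zd : forall A : comPzRingType, zd_relation (@zd_rel A);
  zd_rel_hom : forall (A B : comPzRingType) (f : {rmorphism A -> B}) (a a' : A),
    zd_rel a a' -> zd_rel (f a) (f a')
}.

Arguments zd_rel R {A} a a' : rename.

Section ZdFunctor.
Variable R : zd_family.

Definition zd_relb (A : comPzRingType) : rel A := fun a b => `[< zd_rel R a b >].

Fact zd_relb_refl A : reflexive (@zd_relb A).
Proof. by move=> a; apply/asboolP; have [[]] := zd_rel_zd R A. Qed.

Fact zd_relb_sym A : symmetric (@zd_relb A).
Proof.
have [[_ symR _] _] := zd_rel_zd R A.
by move=> a b; apply: asbool_equiv_eq; split; apply: symR.
Qed.

Fact zd_relb_trans A : transitive (@zd_relb A).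
Proof.
have [[_ _ transR] _] := zd_rel_zd R A.
by move=> b a c /asboolP ab /asboolP bc; apply/asboolP; apply: transR ab bc.
Qed.

Canonical zd_equiv (A : comPzRingType) : equiv_rel A :=
  EquivRel (@zd_relb A) (@zd_relb_refl A) (@zd_relb_sym A) (@zd_relb_trans A).

Definition zd_quot (A : comPzRingType) : Type := {eq_quot zd_equiv A}.

Definition zd_class (A : comPzRingType) (a : A) : zd_quot A :=
  \pi_{eq_quot zd_equiv A} a.

Lemma zd_classP (A : comPzRingType) (a b : A) :
  zd_class a = zd_class b <-> zd_rel R a b.
Proof.
by split=> [/eqmodP/asboolP | ab] //; apply/eqmodP/asboolP.
Qed.

Lemma zd_class_surj (A : comPzRingType) (x : zd_quot A) :
  exists a : A, x = zd_class a.
Proof. by exists (repr x); rewrite /zd_class reprK. Qed.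

Definition zd_adj (A : comPzRingType) (x y : zd_quot A) : Prop :=
  exists a b : A, [/\ x = zd_class a, y = zd_class b & a * b = 0].

Fact zd_adj_sym A (x y : zd_quot A) : zd_adj x y -> zd_adj y x.
Proof. by move=> [a [b [-> -> ab0]]]; exists b, a; rewrite mulrC. Qed.

Definition zeta (A : comPzRingType) : graph := Graph (@zd_adj_sym A).

Lemma zeta_adjE (A : comPzRingType) (a b : A) :
  @adj (zeta A) (zd_class a) (zd_class b) <-> a * b = 0.
Proof.
split=> [[a' [b' [/zd_classP aa' /zd_classP bb' ab0]]] | ab0].
  have [[_ symR _] zdR] := zd_rel_zd R A.
  exact: zdR (symR _ _ aa') (symR _ _ bb') ab0.
by exists a, b.
Qed.

Definition zeta_fun (A B : comPzRingType) (f : {rmorphism A -> B}) :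
  zeta A -> zeta B := fun x => zd_class (f (repr (x : {eq_quot zd_equiv A}))).

Lemma zeta_funE (A B : comPzRingType) (f : {rmorphism A -> B}) (a : A) :
  zeta_fun f (zd_class a) = zd_class (f a).
Proof. by apply/zd_classP/zd_rel_hom/zd_classP; rewrite /zd_class reprK. Qed.

Fact zeta_fun_adj (A B : comPzRingType) (f : {rmorphism A -> B}) (x y : zeta A) :
  adj x y -> adj (zeta_fun f x) (zeta_fun f y).
Proof.
move=> [a [b [-> -> ab0]]]; rewrite !zeta_funE.
by apply/zeta_adjE; rewrite -rmorphM ab0 rmorph0.
Qed.

Definition zeta_mor (A B : comPzRingType) (f : {rmorphism A -> B}) :
  gmor (zeta A) (zeta B) := GMor (@zeta_fun_adj A B f).

Section Canonical.
Variables (A B : comPzRingType) (f g : {rmorphism A -> B}).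

Fact zeta_ring_eq :
  gmor_comp (zeta_mor f) (zeta_mor (ring_eq_incl f g)) =1
  gmor_comp (zeta_mor g) (zeta_mor (ring_eq_incl f g)).
Proof.
move=> x; have [a ->] := zd_class_surj x.
by rewrite /= !zeta_funE ring_eq_inclP.
Qed.

Definition psi :
    gmor (zeta (ring_eq f g)) (graph_eq (zeta_mor f) (zeta_mor g)) :=
  graph_eq_lift zeta_ring_eq.

End Canonical.
End ZdFunctor.

Definition eq_reflecting (R : zd_family) : Prop :=
  forall (A B : comPzRingType) (f g : {rmorphism A -> B}) (a a' : ring_eq f g),
    zd_rel R (ring_eq_incl f g a) (ring_eq_incl f g a') -> zd_rel R a a'.

Definition eq_representable (R : zd_family) : Prop :=
  forall (A B : comPzRingType) (f g : {rmorphism A -> B}) (a : A),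
    zd_rel R (f a) (g a) ->
    exists a' : ring_eq f g, zd_rel R a (ring_eq_incl f g a').

(* Main.v *)
Require Import Defs.
From mathcomp Require Import all_boot all_order all_algebra.
From mathcomp Require Import boolp.

Import GRing.Theory.
Local Open Scope ring_scope.

(** The morphism [psi] sends the class of [a] in the equalizer ring to the class
    of the same [a] in [A]. Both graphs put an edge between two classes exactly
    when the product of representatives vanishes ([zeta_adjE]), and a product
    vanishes in the subring if and only if it vanishes in [A]; this makes [psi]
    strong. For the other two parts, monomorphisms and epimorphisms of graphs
    are the injective and the surjective morphisms, and the two hypotheses on
    the family are injectivity and surjectivity of [psi] read on
    representatives: [psi] identifies two classes when their representatives
    are related in [A], and the class of [a] is a vertex of the target
    when [f a] and [g a] are related in [B]. *)

Lemma sval_psi (R : zd_family) (A B : comPzRingType) (f g : {rmorphism A -> B})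
    (a : ring_eq f g) :
  sval (psi R f g (zd_class R a)) = zd_class R (ring_eq_incl f g a).
Proof. exact: zeta_funE. Qed.

Lemma psi_strong (R : zd_family) (A B : comPzRingType)
    (f g : {rmorphism A -> B}) :
  strong (psi R f g).
Proof.
move=> x y.
have [a ->] := zd_class_surj x; have [b ->] := zd_class_surj y.
move=> /=; rewrite !zeta_funE => /zeta_adjE ab0.
apply/zeta_adjE/val_inj; apply: etrans (rmorphM (ring_eq_incl f g) a b) _.
by rewrite ab0 -(rmorph0 (ring_eq_incl f g)).
Qed.

Lemma psi_inj (R : zd_family) (A B : comPzRingType)
    (f g : {rmorphism A -> B}) :
  eq_reflecting R -> injective (psi R f g).
Proof.
move=> reflR x y.
have [a ->] := zd_class_surj x; have [b ->] := zd_class_surj y.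
move=> /(congr1 sval); rewrite !sval_psi => /zd_classP ab.
exact/zd_classP/reflR.
Qed.

Lemma psi_surj (R : zd_family) (A B : comPzRingType)
    (f g : {rmorphism A -> B}) :
  eq_representable R ->
  forall y : graph_eq (zeta_mor R f) (zeta_mor R g), exists x, psi R f g x = y.
Proof.
move=> reprR [y fgy]; have [a ya] := zd_class_surj y.
have /reprR[a' aa'] : zd_rel R (f a) (g a).
  by apply/zd_classP; move: fgy; rewrite ya /= !zeta_funE.
exists (zd_class R a'); apply: eq_sig_hprop => [z p q|].
  exact: Prop_irrelevance.
by rewrite sval_psi /= ya; apply/esym/zd_classP.
Qed.

Theorem proposition3p15 (R : zd_family) (A B : comPzRingType)
    (f g : {rmorphism A -> B}) :
  strong (psi R f g) /\
  (eq_reflecting R -> graph_mono (psi R f g)) /\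
  (eq_reflecting R -> eq_representable R -> graph_epi (psi R f g)).
Proof.
split; first exact: psi_strong.
split=> [reflR | _ reprR]; first exact/graph_monoP/psi_inj.
exact/graph_epiP/psi_surj.
Qed.
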